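(* Let $k\geq 0$ be an integer. The non-negative integer solutions $(x,y,z)$ of the Diophantine equation $-2^x+(2^k\cdot 5)^y=z^2$ are exactly: $(x,y,z)=(0,0,0)$ (for any $k\geq 0$), and, for each positive integer $n$, $(k,x,y,z)=(n-1,\,2n+2,\,2,\,3\cdot 2^{n-1})$, $(2n-1,\,2n-2,\,1,\,3\cdot 2^{n-1})$, $(2n-2,\,2n-2,\,1,\,2^n)$, $(2n-2,\,2n,\,1,\,2^{n-1})$, and $(2n-2,\,6n-4,\,3,\,11\cdot 8^{n-1})$.
   Context: Here $n$ ranges over the positive integers $\mathbb{N}=\{1,2,3,\dots\}$. *)

(* Defs.v *)
From mathcomp Require Import all_boot all_order all_algebra.

(* Main.v *)
(** Write z = 2^a w with w odd and compare the powers of 2 on both sides of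
    z^2 + 2^x = 2^(ky) 5^y. According to the sign of x - 2a this leaves
    w^2 + 2^m = 5^y, 2^m w^2 + 1 = 5^y (m > 0), or w^2 + 1 = 2 * 5^y with y odd.
    For even y one factors a difference of squares; for odd y = 2h + 1,
    congruences turn these into Pell equations w^2 + 4 = 5 v^2 and
    w^2 + 1 = 10 v^2 with v = 5^h or v = 2 * 5^h. Vieta jumping shows that the
    solutions v form a linear recurrent sequence, and its antiperiodicity forces
    a prime other than 2 and 5 to divide v as soon as h is large enough. *)

From Stdlib Require Import ZArith.
Require Import Defs.
From mathcomp Require Import all_boot all_order all_algebra.
From mathcomp Require Import zify.

(** * Vieta jumping and divisibility in linear recurrences *)

Section Recurrence.

Local Open Scope Z_scope.

(** Shifting the pair of initial terms keeps evaluation by [vm_compute] linear in the index. *)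
Fixpoint lucas (t a b : Z) (n : nat) : Z :=
  if n is S n' then lucas t b (t * b - a) n' else a.

Lemma lucas_rec (t a b : Z) (n : nat) :
  lucas t a b n.+2 = t * lucas t a b n.+1 - lucas t a b n.
Proof. by elim: n a b => [//|n IHn] a b; apply: IHn. Qed.

(* A solution with p > q > 0 descends to (q, t q - p); the only one with p = q
   is (1, 1). *)
Lemma vieta_jumping (t p q : Z) :
  3 <= t -> 0 < q <= p -> p * p + q * q + (t - 2) = t * p * q ->
  exists n, q = lucas t 1 1 n /\ p = lucas t 1 1 n.+1.
Proof.
move=> t_ge3.
have [N] : exists N : nat, p + q <= Z.of_nat N by exists (Z.to_nat (p + q)); lia.
elim: N p q => [|N IHN] p q le_pq_N q_range def_pq; first by lia.
have [eq_pq | neq_pq] := Z.eq_dec p q.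
  exists 0%N; subst p => /=.
  have : (t - 2) * (q * q - 1) = 0 by nia.
  by case/Z.mul_eq_0 => [|sqr_q]; [lia | split; nia].
(* [t * q - p] is the other root of the quadratic solved by p; the product of the roots makes it
   positive. *)
have r_gt0 : 0 < t * q - p.
  apply/(Z.mul_pos_cancel_r _ p); first by lia.
  have -> : (t * q - p) * p = q * q + (t - 2) by lia.
  by nia.
have le_rq : t * q - p <= q.
  (* At q this quadratic has value -(t - 2)(q^2 - 1) <= 0, so q cannot lie strictly below both
     roots. *)
  apply/Z.nlt_ge => lt_qr.
  have : (p - q) * ((t - 1) * q - p) > 0 by nia.
  have : (t - 2) * (q * q) >= t - 2 by nia.
  by nia.
have [||| n [def_r def_q]] := IHN q (t * q - p); [lia | lia | lia |].
by exists n.+1; split=> //; rewrite lucas_rec -def_q -def_r; lia.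
Qed.

(** The sums u_(n+N) + u_n satisfy the same linear recurrence, so their first two values decide. *)
Lemma lucas_antiperiod (t a b M : Z) (N : nat) :
  (M | lucas t a b N + a) -> (M | lucas t a b N.+1 + b) ->
  forall n, (M | lucas t a b (n + N) + lucas t a b n).
Proof.
move=> M0 M1 n.
suff [] : (M | lucas t a b (n + N) + lucas t a b n) /\
          (M | lucas t a b (n.+1 + N) + lucas t a b n.+1) by [].
elim: n => [//|n [IH0 IH1]]; split=> //.
rewrite addSn in IH1; rewrite !addSn !lucas_rec.
move: (Z.divide_sub_r _ _ _ (Z.divide_mul_r _ t _ IH1) IH0).
by congr (_ | _); lia.
Qed.

(** Modulo d e a shift by N only changes signs, so divisibility by d or by e depends on the index
    modulo N alone. *)
Lemma lucas_dvd_transfer (t a b d e : Z) (N : nat) :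
  (0 < N)%N -> d <> 0 -> e <> 0 ->
  (d * e | lucas t a b N + a) -> (d * e | lucas t a b N.+1 + b) ->
  all (fun n => (lucas t a b n mod d =? 0) ==> (lucas t a b n mod e =? 0))
    (iota 0 N) ->
  forall n, (d | lucas t a b n) -> (e | lucas t a b n).
Proof.
move=> N_gt0 d_neq0 e_neq0 M0 M1 /allP small.
elim/ltn_ind=> n IHn d_dvd_un.
have [n_small | n_large] := ltnP n N.
  have := small n; rewrite mem_iota n_small => /(_ isT) /implyP chk.
  apply/(Z.mod_divide _ _ e_neq0)/Z.eqb_eq/chk/Z.eqb_eq.
  exact/(Z.mod_divide _ _ d_neq0).
have := lucas_antiperiod t a b (d * e) N M0 M1 (n - N); rewrite subnK // => per.
have d_per : (d | lucas t a b n + lucas t a b (n - N)).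
  by apply: Z.divide_trans per; exists e; lia.
have e_per : (e | lucas t a b n + lucas t a b (n - N)).
  by apply: Z.divide_trans per; exists d; lia.
have d_dvd_um : (d | lucas t a b (n - N)).
  by move: (Z.divide_sub_r _ _ _ d_per d_dvd_un); rewrite Z.add_simpl_l.
have e_dvd_um : (e | lucas t a b (n - N)) by apply: IHn => //; lia.
by move: (Z.divide_sub_r _ _ _ e_per e_dvd_um); rewrite Z.add_simpl_r.
Qed.

(* The pair p = (3 v + w) / 2, q = v satisfies the equation of [vieta_jumping]
   with t = 3; below, p = 19 v + 6 w, q = v satisfies it with t = 38. *)
Lemma pell5_lucas (w v : Z) :
  0 <= w -> 0 < v -> w * w + 4 = 5 * v * v -> exists n, v = lucas 3 1 1 n.
Proof.
move=> w_ge0 v_gt0 def_w.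
have [p def_p] : exists p, 2 * p = 3 * v + w.
  have [[a def_a] | [a def_a]] := Z.Even_or_Odd w;
    have [[b def_b] | [b def_b]] := Z.Even_or_Odd v; rewrite {}def_a {}def_b in def_w *;
    try lia.
  - by exists (3 * b + a); lia.
  - by exists (3 * b + a + 2); lia.
have [|||n [-> _]] := vieta_jumping 3 p v; [lia | nia | nia |].
by exists n.
Qed.

Lemma pell10_lucas (w v : Z) :
  0 <= w -> 0 < v -> w * w + 1 = 10 * v * v -> exists n, v = lucas 38 1 1 n.
Proof.
move=> w_ge0 v_gt0 def_w.
have [|||n [-> _]] := vieta_jumping 38 (19 * v + 6 * w) v; [lia | nia | nia |].
by exists n.
Qed.

(* [lucas 3 1 1] lists the Fibonacci numbers of odd index (the first one twice);
   3001 divides F_25, 61 divides F_15. *)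
Lemma pell5_dvd25 (w v : Z) :
  0 <= w -> 0 < v -> w * w + 4 = 5 * v * v -> (25 | v) -> (3001 | v).
Proof.
move=> w_ge0 v_gt0 /(pell5_lucas _ _ w_ge0 v_gt0)[n ->].
(* The shift 25 comes from F_(m+50) + F_m = F_25 L_(m+25), with L the Lucas numbers, and F_25 = 25 *
   3001. *)
by apply: (lucas_dvd_transfer _ _ _ _ _ 25);
  try apply/Z.mod_divide; vm_compute.
Qed.

Lemma pell5_dvd10 (w v : Z) :
  0 <= w -> 0 < v -> w * w + 4 = 5 * v * v -> (10 | v) -> (61 | v).
Proof.
move=> w_ge0 v_gt0 /(pell5_lucas _ _ w_ge0 v_gt0)[n ->].
(* Likewise with F_15 = 10 * 61. *)
by apply: (lucas_dvd_transfer _ _ _ _ _ 15);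
  try apply/Z.mod_divide; vm_compute.
Qed.

(** Modulo 1405 = 5 * 281, its term of index 3, [lucas 38 1 1] runs 1, 1, 37, 0, -37, -1, -1: a
    shift by 5 changes the sign. *)
Lemma pell10_dvd5 (w v : Z) :
  0 <= w -> 0 < v -> w * w + 1 = 10 * v * v -> (5 | v) -> (281 | v).
Proof.
move=> w_ge0 v_gt0 /(pell10_lucas _ _ w_ge0 v_gt0)[n ->].
by apply: (lucas_dvd_transfer _ _ _ _ _ 5);
  try apply/Z.mod_divide; vm_compute.
Qed.

End Recurrence.

(** * Pell equations with odd powers of 5 *)

Local Open Scope nat_scope.

Lemma expn_double_succ (m h : nat) : m ^ h.*2.+1 = m * (m ^ h) ^ 2.
Proof. by rewrite expnS -muln2 expnM. Qed.

Lemma sqr_add4_pow5 (w h : nat) : w ^ 2 + 4 = 5 ^ h.*2.+1 -> h <= 1.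
Proof.
case: h => [//|[//|h]] def_w.
have d25 : 25 %| 5 ^ h.+2 by rewrite (dvdn_exp2l 5 (isT : 2 <= h.+2)).
have : 3001 %| 5 ^ h.+2.
  have := pell5_dvd25 (Z.of_nat w) (Z.of_nat (5 ^ h.+2)).
  have v_gt0 : 0 < 5 ^ h.+2 by rewrite expn_gt0.
  move: def_w d25; rewrite expn_double_succ.
  move: (5 ^ h.+2) v_gt0 => v v_gt0; rewrite !expnS !expn0 !muln1.
  move=> def_w d25 H.
  have [||||c] := H; [lia | lia | lia | |lia].
  by exists (Z.of_nat (v %/ 25)); lia.
by rewrite Euclid_dvdX.
Qed.

(** Multiplying by 4 gives (2w)^2 + 4 = 5 v^2 with v = 2 * 5^h; for h > 0, 10 divides v, hence so
    does 61. *)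
Lemma sqr_add1_pow5 (w h : nat) : w ^ 2 + 1 = 5 ^ h.*2.+1 -> h = 0.
Proof.
case: h => [//|h] def_w.
have d5 : 5 %| 5 ^ h.+1 by rewrite dvdn_exp.
have : 61 %| 2 * 5 ^ h.+1.
  have := pell5_dvd10 (Z.of_nat (2 * w)) (Z.of_nat (2 * 5 ^ h.+1)).
  have v_gt0 : 0 < 5 ^ h.+1 by rewrite expn_gt0.
  move: def_w d5; rewrite expn_double_succ.
  move: (5 ^ h.+1) v_gt0 => v v_gt0; rewrite !expnS !expn0 !muln1.
  move=> def_w d5 H.
  have [||||c] := H; [lia | lia | lia | |lia].
  by exists (Z.of_nat (v %/ 5)); lia.
by rewrite Euclid_dvdM // Euclid_dvdX.
Qed.

Lemma sqr_add1_double_pow5 (w h : nat) : w ^ 2 + 1 = 2 * 5 ^ h.*2.+1 -> h = 0.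
Proof.
case: h => [//|h] def_w.
have d5 : 5 %| 5 ^ h.+1 by rewrite dvdn_exp.
have : 281 %| 5 ^ h.+1.
  have := pell10_dvd5 (Z.of_nat w) (Z.of_nat (5 ^ h.+1)).
  have v_gt0 : 0 < 5 ^ h.+1 by rewrite expn_gt0.
  move: def_w d5; rewrite expn_double_succ.
  move: (5 ^ h.+1) v_gt0 => v v_gt0; rewrite !expnS !expn0 !muln1.
  move=> def_w d5 H.
  have [||||c] := H; [lia | lia | lia | |lia].
  by exists (Z.of_nat (v %/ 5)); lia.
by rewrite Euclid_dvdX.
Qed.

(** * Exponential equations for the odd part of z *)

Lemma odd_mul_pow2_inj (a b m n : nat) :
  odd m -> odd n -> 2 ^ a * m = 2 ^ b * n -> a = b /\ m = n.
Proof.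
move=> odd_m odd_n eq_mn.
have logE c p : odd p -> logn 2 (2 ^ c * p) = c.
  move=> odd_p; have p_gt0 := odd_gt0 odd_p.
  rewrite lognM ?expn_gt0 // pfactorK //.
  by rewrite logn_coprime ?addn0 // coprime2n.
have eq_ab : a = b by rewrite -(logE a m odd_m) eq_mn logE.
split=> //; apply/eqP; move/eqP: eq_mn.
by rewrite eq_ab eqn_pmul2l ?expn_gt0.
Qed.

Lemma odd_exp5 (y : nat) : odd (5 ^ y). Proof. by rewrite oddX orbT. Qed.

Lemma pow2_add1_pow5 (c h : nat) : 2 ^ c + 1 = 5 ^ h -> c = 2 /\ h = 1.
Proof.
case: c => [|[|[|c]]] eq_ch.
- by have := odd_exp5 h; rewrite -eq_ch.
- by case: h eq_ch => [//|h]; rewrite (expnS 5) => eq_h; lia.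
- by split=> //; apply: (@expnI 5); rewrite // -eq_ch.
(* With an exponent of at least 3 the left side is 1 modulo 8, but 5^h is 5 for odd h; for even h, 3
   divides 5^h - 1, a power of 2. *)
have exp25 j : 5 ^ j.*2 %% 24 = 1.
  by rewrite -mul2n expnM -modnXm exp1n.
have exp25h := exp25 h./2; have := odd_double_half h.
case: (odd h) => def_h; move: eq_ch; rewrite -{}def_h ?add1n ?add0n.
  by rewrite (expnS 5) !(expnS 2); lia.
move=> eq_ch; have : 3 %| 2 ^ c.+3 by lia.
by rewrite Euclid_dvdX.
Qed.

Lemma sqr_add_pow2_pow5 (w m y : nat) :
  odd w -> 0 < m -> w ^ 2 + 2 ^ m = 5 ^ y ->
  (w, m, y) \in [:: (1, 2, 1); (3, 4, 2); (11, 2, 3)].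
Proof.
move=> odd_w m_gt0 eq_wmy.
have := odd_double_half y; case: (odd y) => def_y.
  have mod24 : 5 ^ y %% 24 = 5.
    by rewrite -{}def_y expn_double_succ expnAC -modnMmr -modnXm exp1n.
  have mod8 : w ^ 2 %% 8 = 1.
    rewrite -modnXm; have := ltn_pmod w (isT : 0 < 8).
    have : odd (w %% 8).
      by move: odd_w; rewrite {1}(divn_eq w 8) oddD oddM andbF.
    by case: (w %% 8) => [|[|[|[|[|[|[|[|]]]]]]]].
  (* Modulo 8 the equation reads 1 + 2^m = 5. *)
  have m2 : m = 2.
    case: m m_gt0 eq_wmy => [//|[|[//|m]]] _; first by lia.
    rewrite !(expnS 2); move: (w ^ 2) (5 ^ y) (2 ^ m) mod8 mod24; lia.
  rewrite m2 -def_y add1n in eq_wmy *.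
  have := sqr_add4_pow5 _ _ eq_wmy.
  case: y./2 eq_wmy => [|[|//]] eq_w _.
    have -> : w = 1 by nia.
    by [].
  have -> : w = 11 by nia.
  by [].
(* For y = 2h both factors of 5^(2h) - w^2 are powers of 2; the odd part of their sum 2 * 5^h gives
   2^(b-a) + 1 = 5^h. *)
set h := y./2 in def_y; rewrite add0n -muln2 in def_y.
have factored : (5 ^ h - w) * (5 ^ h + w) = 2 ^ m.
  by rewrite -subn_sqr -expnM def_y -eq_wmy addKn.
have [a _ def_a] : exists2 a, a <= m & 5 ^ h - w = 2 ^ a.
  by apply/dvdn_pfactor; rewrite // -factored dvdn_mulr.
have [b _ def_b] : exists2 b, b <= m & 5 ^ h + w = 2 ^ b.
  by apply/dvdn_pfactor; rewrite // -factored dvdn_mull.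
have lt_ab : a < b.
  rewrite -(ltn_exp2l _ _ (isT : 1 < 2)) -def_a -def_b.
  by have := odd_gt0 odd_w; lia.
have sum_ab : 2 ^ 1 * 5 ^ h = 2 ^ a * (2 ^ (b - a) + 1).
  rewrite mulnDr -expnD subnKC ?(ltnW lt_ab) // muln1 -def_b -def_a.
  by have : 0 < 2 ^ a by [rewrite expn_gt0]; lia.
have odd_sum : odd (2 ^ (b - a) + 1).
  by rewrite addn1 /= oddX subn_eq0 leqNgt lt_ab.
have [a1 /esym eq_ch] := odd_mul_pow2_inj _ _ _ _ (odd_exp5 h) odd_sum sum_ab.
have [ba2 h1] := pow2_add1_pow5 _ _ eq_ch.
rewrite -a1 h1 in def_a; have w3 : w = 3 by lia.
have m4 : m = 4.
  by apply: (@expnI 2) => //; rewrite -factored h1 w3.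
by rewrite w3 m4 -def_y h1.
Qed.

Lemma pow2_mul_sqr_add1_pow5 (w m y : nat) :
  odd w -> 0 < m -> 2 ^ m * w ^ 2 + 1 = 5 ^ y -> [/\ w = 1, m = 2 & y = 1].
Proof.
move=> odd_w m_gt0 eq_wmy.
have w_gt0 := odd_gt0 odd_w.
have lhs_gt1 : 1 < 2 ^ m * w ^ 2 + 1.
  by rewrite addn1 ltnS muln_gt0 !expn_gt0 w_gt0.
have def_m := odd_double_half m.
have sqrE : 2 ^ m./2.*2 * w ^ 2 = (2 ^ m./2 * w) ^ 2.
  by rewrite expnMn -muln2 expnM.
case: (odd m) def_m => def_m.
  have y_gt0 : 0 < y by case: y eq_wmy => [|//]; lia.
  move: eq_wmy; rewrite -def_m add1n (expnS 2) -mulnA sqrE -(prednK y_gt0) (expnS 5).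
  move: (2 ^ _ * w) => v eq_v.
  (* This would make 2 a square modulo 5. *)
  have : (2 * (v %% 5) ^ 2 + 1) %% 5 = 0.
    by rewrite -modnDml -modnMmr modnXm modnMmr modnDml eq_v modnMr.
  have := ltn_pmod v (isT : 0 < 5).
  by case: (v %% 5) => [|[|[|[|[|]]]]].
rewrite add0n in def_m.
have def_y := odd_double_half y; case: (odd y) def_y => def_y.
  have eq_vy : (2 ^ m./2 * w) ^ 2 + 1 = 5 ^ y./2.*2.+1.
    by rewrite -sqrE def_m eq_wmy -{1}def_y.
  have h0 := sqr_add1_pow5 _ _ eq_vy; rewrite h0 in def_y eq_vy.
  have v2 : 2 ^ m./2 * w = 2 ^ 1 * 1 by nia.
  have [m1 w1] := odd_mul_pow2_inj _ _ _ _ odd_w (isT : odd 1) v2.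
  by split; [exact: w1 | rewrite -def_m m1 | rewrite -def_y].
(* Two positive squares cannot differ by 1. *)
have : (2 ^ m./2 * w) ^ 2 + 1 = (5 ^ y./2) ^ 2.
  by rewrite -sqrE def_m eq_wmy -{1}def_y add0n -muln2 expnM.
have : 0 < 2 ^ m./2 * w by rewrite muln_gt0 expn_gt0.
move: (2 ^ m./2 * w) (5 ^ y./2) => u v u_gt0 eq_uv.
by have : u < v; nia.
Qed.

Lemma sqr_add1_double_pow5_odd (w y : nat) :
  odd y -> w ^ 2 + 1 = 2 * 5 ^ y -> w = 3 /\ y = 1.
Proof.
move=> odd_y; have := odd_double_half y; rewrite odd_y add1n => <- eq_wy.
have h0 := sqr_add1_double_pow5 _ _ eq_wy.
by rewrite h0 in eq_wy *; split=> //; nia.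
Qed.

(** * Comparison of x with twice the 2-adic valuation of z *)

Lemma sqr_add_pow2_cases (k x y z : nat) :
  z ^ 2 + 2 ^ x = (2 ^ k * 5) ^ y ->
  (x, y, z) = (0, 0, 0) \/
  exists a,
    [/\ k * y = a.*2, x = a.*2 + 4, y = 2 & z = 3 * 2 ^ a] \/
    [/\ k * y = a.*2.+1, x = a.*2, y = 1 & z = 3 * 2 ^ a] \/
    [/\ k * y = a.*2, x = a.*2, y = 1 & z = 2 ^ a.+1] \/
    [/\ k * y = a.*2, x = a.*2 + 2, y = 1 & z = 2 ^ a] \/
    [/\ k * y = a.*2, x = a.*2 + 2, y = 3 & z = 11 * 2 ^ a].
Proof.
rewrite expnMn -expnM => eq_xyz.
have [z0 | z_gt0] := posnP z.
  left; rewrite z0 add0n -[LHS]muln1 in eq_xyz.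
  have [-> pow5_y] := odd_mul_pow2_inj _ _ _ _ (isT : odd 1) (odd_exp5 y) eq_xyz.
  have -> : y = 0 by apply: (@expnI 5).
  by rewrite muln0 z0.
have [w co2w def_z] := pfactor_coprime (isT : prime 2) z_gt0.
rewrite coprime2n in co2w; right.
move: (logn 2 z) def_z => b def_z.
have sqr_z : z ^ 2 = 2 ^ b.*2 * w ^ 2.
  by rewrite def_z expnMn mulnC -expnM muln2.
have odd_w2 : odd (w ^ 2) by rewrite oddX co2w orbT.
rewrite sqr_z {sqr_z} in eq_xyz.
have [lt_xb | lt_bx | eq_xb] := ltngtP x b.*2.
- have def_b : b.*2 = x + (b.*2 - x) by rewrite subnKC // ltnW.
  have m_gt0 : 0 < b.*2 - x by rewrite subn_gt0.
  move: (b.*2 - x) m_gt0 def_b => m m_gt0 def_b.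
  rewrite def_b expnD -mulnA -{2}[2 ^ x]muln1 -mulnDr in eq_xyz.
  have odd_sum : odd (2 ^ m * w ^ 2 + 1).
    by rewrite addn1 /= oddM oddX eqn0Ngt m_gt0.
  have [eq_ky eq_wmy] := odd_mul_pow2_inj _ _ _ _ odd_sum (odd_exp5 y) eq_xyz.
  have [w1 m2 y1] := pow2_mul_sqr_add1_pow5 _ _ _ co2w m_gt0 eq_wmy.
  (* Here 2b = x + 2, so b > 0 and a = b - 1. *)
  exists b.-1; do 2!right; left; rewrite def_z w1 y1 mul1n.
  by split; [lia | lia | lia | congr (2 ^ _); lia].
- have def_x : x = b.*2 + (x - b.*2) by rewrite subnKC // ltnW.
  have m_gt0 : 0 < x - b.*2 by rewrite subn_gt0.
  move: (x - b.*2) m_gt0 def_x => m m_gt0 def_x.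
  rewrite def_x expnD -mulnDr in eq_xyz.
  have odd_sum : odd (w ^ 2 + 2 ^ m).
    by rewrite oddD odd_w2 oddX eqn0Ngt m_gt0.
  have [eq_ky eq_wmy] := odd_mul_pow2_inj _ _ _ _ odd_sum (odd_exp5 y) eq_xyz.
  have := sqr_add_pow2_pow5 _ _ _ co2w m_gt0 eq_wmy.
  rewrite !inE -eq_ky def_x def_z => cases; exists b.
  case/or3P: cases => /eqP[-> -> ->].
  + by do 3!right; left; rewrite mul1n.
  + by left.
  + by do 4!right.
- rewrite eq_xb -{2}[2 ^ _]muln1 -mulnDr in eq_xyz.
  (* w^2 + 1 is 2 modulo 4; this one extra factor 2 makes k y = 2b + 1, hence y, odd. *)
  have sum_even : w ^ 2 + 1 = 2 * (w ^ 2 + 1)./2.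
    by rewrite mul2n -[LHS]odd_double_half oddD odd_w2.
  have odd_half : odd (w ^ 2 + 1)./2.
    rewrite -(odd_double_half w) co2w; move: (w./2) => v.
    have -> : (true + v.*2) ^ 2 + 1 = (2 * (v * v + v)).+1.*2 by nia.
    by rewrite doubleK /= oddM.
  rewrite sum_even mulnA -expnSr in eq_xyz.
  have [eq_ky eq_wy] := odd_mul_pow2_inj _ _ _ _ odd_half (odd_exp5 y) eq_xyz.
  rewrite eq_wy in sum_even.
  have odd_y : odd y.
    by have : odd (k * y) by [rewrite -eq_ky /= odd_double]; rewrite oddM => /andP[].
  have [w3 y1] := sqr_add1_double_pow5_odd _ _ odd_y sum_even.
  by exists b; right; left; rewrite eq_xb def_z w3.
Qed.

(** * Parametrisation by n *)

Local Open Scope ring_scope.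

Theorem theorem3p5 (k x y z : nat) :
  (- (2%:Z ^+ x) + (2%:Z ^+ k * 5%:Z) ^+ y = z%:Z ^+ 2) <->
  ((x, y, z) = (0, 0, 0)%N \/
   exists n : nat, (0 < n)%N /\
     ((k, x, y, z) = (n - 1, 2 * n + 2, 2, 3 * 2 ^ (n - 1))%N \/
      (k, x, y, z) = (2 * n - 1, 2 * n - 2, 1, 3 * 2 ^ (n - 1))%N \/
      (k, x, y, z) = (2 * n - 2, 2 * n - 2, 1, 2 ^ n)%N \/
      (k, x, y, z) = (2 * n - 2, 2 * n, 1, 2 ^ (n - 1))%N \/
      (k, x, y, z) = (2 * n - 2, 6 * n - 4, 3, 11 * 8 ^ (n - 1))%N)).
Proof.
have -> : (- (2%:Z ^+ x) + (2%:Z ^+ k * 5%:Z) ^+ y = z%:Z ^+ 2) <->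
    (z ^ 2 + 2 ^ x = (2 ^ k * 5) ^ y)%N.
  have powZ m n : m%:Z ^+ n = (m ^ n)%N%:Z.
    by elim: n => // n IHn; rewrite GRing.exprS IHn -PoszM -expnS.
  by rewrite (powZ _ x) (powZ _ k) (powZ z) -PoszM powZ; lia.
split.
  move=> eq_xyz; have [zero_sol | [a sol]] := sqr_add_pow2_cases _ _ _ _ eq_xyz.
    by left.
  right; move: sol.
  have pow8 b : (8 ^ b = 2 ^ (3 * b))%N by rewrite expnM.
  case=> [|[|[|[]]]] [ky -> y_val ->]; rewrite {}y_val in ky *.
  - exists a.+1; split=> //; left; rewrite (subn1 a.+1) /=.
    by congr (_, _, _, _); lia.
  - exists a.+1; split=> //; right; left; rewrite (subn1 a.+1) /=.
    by congr (_, _, _, _); lia.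
  - exists a.+1; split=> //; do 2!right; left.
    by congr (_, _, _, _); lia.
  - exists a.+1; split=> //; do 3!right; left; rewrite (subn1 a.+1) /=.
    by congr (_, _, _, _); lia.
  (* 3k = 2a makes a a multiple of 3, so 2^a is a power of 8. *)
  - exists (a %/ 3).+1; split=> //; do 4!right; rewrite (subn1 _.+1) pow8 /=.
    by congr (_, _, _, (_ * 2 ^ _)%N); lia.
case=> [[-> -> ->] //|[[|a] [] // _]].
(* Without truncated subtractions, every power of 2 becomes a polynomial in [2 ^ a]. *)
have -> : (2 * a.+1 - 1 = a * 2 + 1)%N by lia.
have -> : (2 * a.+1 - 2 = a * 2)%N by lia.
have -> : (2 * a.+1 + 2 = a * 2 + 4)%N by lia.
have -> : (2 * a.+1 = a * 2 + 2)%N by lia.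
have -> : (6 * a.+1 - 4 = a * 6 + 2)%N by lia.
have -> : (8 ^ (a.+1 - 1) = (2 ^ a) ^ 3)%N by rewrite subn1 -expnM mulnC expnM.
by rewrite (subn1 a.+1) /=; case=> [|[|[|[]]]] [-> -> -> ->];
  rewrite ?(expnS 2 a) ?expnD ?expnM; lia.
Qed.
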